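(* Let $\alpha \in [0,1]$. If $B\subseteq \mathbb{N}$ is a highly sparse set, then there exists a set $A\subset \mathbb{N}$ such that the sumset $A+B=\{a+b: a\in A, b\in B\}$ has asymptotic density $d(A+B) = \alpha$.
   Context: $\mathbb{N}=\{1,2,3,\ldots\}$. For $A\subseteq\mathbb{N}$, write $A(n)=\#(A\cap[1,n])$; the lower and upper asymptotic densities are $\underline{d}(A)=\liminf_{n\to\infty} A(n)/n$ and $\overline{d}(A)=\limsup_{n\to\infty}A(n)/n$, and if they are equal their common value is the asymptotic density $d(A)$. A set $B=\{b_1<b_2<\cdots\}\subseteq\mathbb{N}$ is called highly sparse if $B$ is either finite, or infinite with $b_{j+1}/b_j\to\infty$ as $j\to\infty$.
   Formalization: The set B is assumed nonempty; for B empty (finite, hence highly sparse) the sumset A+B is empty and has density 0, so the claim fails for every α > 0. *)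

(* Defs.v *)
From mathcomp Require Import all_boot all_order all_algebra.
From mathcomp Require Import all_classical all_reals all_analysis.

Set Implicit Arguments.
Unset Strict Implicit.
Unset Printing Implicit Defensive.

Import Order.TTheory GRing.Theory Num.Theory.
Import numFieldNormedType.Exports.

Local Open Scope classical_set_scope.
Local Open Scope ring_scope.

(* The natural numbers of the text start at 1; a subset of them is an
   A : set nat with A `<=` positive_nats. *)
Definition positive_nats : set nat := [set n | (0 < n)%N].

(* The number of elements of A in [1, n]. *)
Definition counting_function (A : set nat) (n : nat) : nat :=
  count (fun k => `[< A k >]) (iota 1 n).

Definition lower_density (R : realType) (A : set nat) : \bar R :=
  limn_einf (fun n => ((counting_function A n)%:R / n%:R : R)%:E).

Definition upper_density (R : realType) (A : set nat) : \bar R :=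
  limn_esup (fun n => ((counting_function A n)%:R / n%:R : R)%:E).

Definition has_density (R : realType) (A : set nat) (alpha : R) : Prop :=
  lower_density R A = alpha%:E /\ upper_density R A = alpha%:E.

Definition sumset (A B : set nat) : set nat :=
  [set (a + b)%N | a in A & b in B].

(* In the infinite case b is the (unique) increasing enumeration of B,
   indexed from 0. *)
Definition highly_sparse (R : realType) (B : set nat) : Prop :=
  finite_set B \/
  (infinite_set B /\
   exists b : nat -> nat,
     [/\ {homo b : i j / (i < j)%N >-> (i < j)%N},
         range b = B &
         ((b j.+1)%:R / (b j)%:R : R) @[j --> \oo] --> +oo]).

(* Main.v *)
Require Import Defs.
From mathcomp Require Import all_boot all_order all_algebra.
From mathcomp Require Import all_classical all_reals all_analysis.
From mathcomp Require Import zify ring lra.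

(** Enumerate [B] as [b 0 < b 1 < ...] and pick scales [b k << P k << N k << b k.+1]
    such that [b k.+1] is, up to an error [o(P k)], a multiple of [P k]. In the block
    [N k < x <= N k.+1] let [A] consist of the [x] with [x mod P k < alpha * P k], so
    that [A] has density [alpha]. Up to the end of that block only the shifts by
    [b 0, ..., b k.+1] matter: those by at most [b k] and the one by [b k.+1] move
    residues mod [P k] by [o(P k)], so each window of length [P k] gains [o(P k)]
    elements. Summands [a] from earlier blocks only produce elements of
    [(N k, N k + b k]] and [(b k.+1, b k.+1 + N k]], which are negligible. Hence
    [A + B] exceeds [A] by [o(n)], while it contains a translate of [A].
    A finite [B] is handled by taking [b k = M * k!] with [B] below [M]. *)

Set Implicit Arguments.
Unset Strict Implicit.
Unset Printing Implicit Defensive.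

Import Order.TTheory GRing.Theory Num.Theory.
Import numFieldNormedType.Exports.

Local Open Scope classical_set_scope.

Lemma diagonal_near (G : nat -> nat -> Prop) :
  (forall c, \forall k \near \oo, G c k) ->
  exists2 m : nat -> nat, m k @[k --> \oo] --> \oo &
    \forall k \near \oo, G (m k) k.
Proof.
move=> nearG; pose good k (i : 'I_k.+1) := `[< G i k >].
exists (fun k => \max_(i | good k i) i).
  apply/cvgnyPge => c; apply: filterS2 (nbhs_infty_ge c) (nearG c) => k ck Gck.
  by apply: (leq_bigmax_cond (Ordinal (ck : c < k.+1))); apply/asboolP.
apply: filterS (nearG 0) => k G0k.
have [|i /asboolP Gi ->//] := @eq_bigmax_cond _ (good k) (@nat_of_ord _).
by apply/card_gt0P; exists ord0; apply/asboolP.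
Qed.

Lemma itv_of_increasing (N : nat -> nat) (K v : nat) :
  (forall k, N k < N k.+1) -> N K <= v ->
  exists2 k, K <= k & N k <= v < N k.+1.
Proof.
move=> N_incr NK.
have N_ge k : k <= N k by elim: k => // k IH; apply: leq_ltn_trans IH (N_incr k).
have bounded k : N k <= v -> k <= v by apply: leq_trans.
case: (ex_maxnP (ex_intro (fun k => N k <= v) K NK) bounded) => k kv kmax.
exists k; first exact: kmax.
by rewrite kv ltnNge; apply/negP => /kmax; rewrite ltnn.
Qed.

Lemma counting_functionS (S : set nat) (n : nat) :
  counting_function S n.+1 = counting_function S n + `[< S n.+1 >].
Proof.
by rewrite /counting_function -(addn1 n) iotaD count_cat /= addn0 add1n addn1.
Qed.

Lemma counting_function_addn_le (S : set nat) (n k : nat) :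
  counting_function S (n + k) <= counting_function S n + k.
Proof.
rewrite /counting_function iotaD count_cat leq_add2l.
by rewrite -{2}(size_iota (1 + n) k) count_size.
Qed.

Lemma counting_function_le (S : set nat) (n : nat) : counting_function S n <= n.
Proof. exact: counting_function_addn_le S 0 n. Qed.

Lemma counting_function_increment_le (S T U : set nat) (u v : nat) : u <= v ->
  (forall x, u < x <= v -> S x -> T x \/ U x) ->
  counting_function S v + counting_function T u <=
  counting_function S u + counting_function T v + counting_function U v.
Proof.
elim: v => [|v IH]; first by rewrite leqn0 => /eqP -> _; rewrite leq_addr.
rewrite leq_eqVlt ltnS => /predU1P[->|uv STU]; first by rewrite leq_addr.
have := IH uv (fun x ux => STU x ltac:(lia)).
rewrite !counting_functionS; have := STU v.+1 ltac:(lia).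
case: (asboolP (S v.+1)) => [Sv|_ _]; last by lia.
by move/(_ Sv) => -[/asboolP|/asboolP] ->; lia.
Qed.

Lemma counting_function0 (n : nat) : counting_function set0 n = 0.
Proof. by elim: n => // n IH; rewrite counting_functionS IH asboolF. Qed.

Lemma counting_functionU_le (S T : set nat) (n : nat) :
  counting_function (S `|` T) n <= counting_function S n + counting_function T n.
Proof.
have := @counting_function_increment_le (S `|` T) S T 0 n isT.
by rewrite addn0; exact.
Qed.

Lemma counting_function_itv (a w n : nat) :
  counting_function [set x | a < x <= a + w] n = minn (n - a) w.
Proof.
elim: n => [|n IH]; first by rewrite sub0n min0n.
by rewrite counting_functionS IH asboolb; lia.
Qed.

Lemma counting_function_sumset_ge (A B : set nat) (y n : nat) : B y ->
  counting_function A n <= counting_function (sumset A B) n + y.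
Proof.
move=> By; apply: leq_trans (counting_function_addn_le _ n y).
elim: n => // n IH; rewrite addSn !counting_functionS leq_add //.
case: asboolP => // An; rewrite lt0b; apply/asboolP.
by exists n.+1 => //; exists y.
Qed.

Lemma modn_divn_lt (n d : nat) : 0 < d -> n %% (n %/ d) < d.
Proof.
move=> d0; have -> : n %% (n %/ d) = (n %% d) %% (n %/ d).
  by rewrite {1}(divn_eq n d) mulnC modnMDl.
exact: leq_ltn_trans (leq_mod _ _) (ltn_pmod _ d0).
Qed.

Definition low_residues (P h : nat) : set nat := [set x | x %% P < h].

Lemma low_residuesD (P h s x y : nat) :
  low_residues P h x -> y %% P <= s -> low_residues P (h + s) (x + y).
Proof.
rewrite /low_residues /= -modnDm => xh ys; apply: leq_ltn_trans (leq_mod _ _) _.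
by rewrite -addSn leq_add.
Qed.

Lemma low_residues_minn (P h : nat) : 0 < P ->
  low_residues P (minn h P) = low_residues P h.
Proof.
move=> P0; apply/seteqP.
by split=> x; rewrite /low_residues /= leq_min ltn_pmod // andbT.
Qed.

Lemma counting_function_low_residues (P h n : nat) : 0 < P -> h <= P ->
  counting_function (low_residues P h) n = h * (n %/ P) + minn h.-1 (n %% P).
Proof.
move=> P0 hP; elim: n => [|n IH]; first by rewrite div0n mod0n minn0 muln0.
rewrite counting_functionS IH asboolb divnS // modnS; have := ltn_pmod n P0.
have [dvd rP|ndvd rP] := boolP (P %| n.+1); last by lia.
suff -> : n %% P = P.-1 by rewrite mulnDr; lia.
move: dvd; rewrite /dvdn => /eqP.
rewrite -addn1 -modnDml; have [e|ne] := eqVneq ((n %% P) + 1) P; first by lia.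
by rewrite modn_small; lia.
Qed.

Lemma counting_function_low_residues_bounds (P h n : nat) : 0 < P -> h <= P ->
  h * n <= P * (counting_function (low_residues P h) n + 1) <= h * n + P * P.
Proof.
move=> P0 hP; rewrite counting_function_low_residues // {1 4}(divn_eq n P).
have := ltn_pmod n P0; set r := n %% P; set q := n %/ P => rP.
by rewrite !mulnDr (mulnCA P h q) (mulnC P q); case: (leqP h.-1 r) => hr; nia.
Qed.

Definition block_residues (P h N : nat -> nat) : set nat :=
  \bigcup_k ([set x | N k < x <= N k.+1] `&` low_residues (P k) (h k)).

Lemma block_residuesE (P h N : nat -> nat) (k x : nat) :
  (forall i, N i < N i.+1) -> N k < x <= N k.+1 ->
  block_residues P h N x <-> low_residues (P k) (h k) x.
Proof.
move=> N_incr /andP[Nx xN].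
have N_homo : {homo N : i j / i <= j}.
  by apply: homo_leq leqnn leq_trans _ => i; exact: ltnW.
split=> [[j _ [/= /andP[Njx xNj] xh]]|xh]; last by exists k => //; rewrite /= Nx xN.
suff -> : k = j by [].
have [lt_kj|lt_jk|//] := ltngtP k j.
  by have := N_homo _ _ lt_kj; lia.
by have := N_homo _ _ lt_jk; lia.
Qed.

Lemma highly_sparse_gaps (R : realType) (B : set nat) :
  B `<=` positive_nats -> highly_sparse R B ->
  exists b : nat -> nat, [/\ forall k, 0 < b k,
    forall c, \forall k \near \oo, c * b k <= b k.+1 &
    forall k y, B y -> y <= b k \/ b k.+1 <= y].
Proof.
move=> Bpos [finB|[_ [b [b_homo range_b b_ratio]]]].
  have [M BM] : exists M, forall y, B y -> y <= M.
    move: finB => /finite_fsetP[X ->].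
    exists (\max_(y <- finmap.enum_fset X) y) => y /= yX.
    exact: (leq_bigmax_seq (F := id)).
  exists (fun k => M.+1 * k`!); split=> [k|c|k y /BM yM].
  - by rewrite muln_gt0 fact_gt0.
  - near=> k; rewrite mulnCA leq_mul2l factS leq_mul2r.
    by rewrite (leqW (n := k)) ?orbT //; near: k; exact: nbhs_infty_ge.
  - by left; rewrite (leq_trans (leqW yM)) // leq_pmulr // fact_gt0.
have b_pos k : 0 < b k by apply: Bpos; rewrite -range_b; exists k.
exists b; split=> // [c|k y].
  move/cvgryPge: b_ratio => /(_ c%:R%R); apply: filterS => k.
  by rewrite ler_pdivlMr ?ltr0n // -natrM ler_nat.
rewrite -range_b => -[j _ <-]; have b_mono := ltnW_homo b_homo.
by have [jk|kj] := leqP j k; [left|right]; exact: b_mono.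
Unshelve. all: by end_near. Qed.

(* [m k] quantifies the separations [b k << P k << N k << b k.+1]; moreover
   [b k.+1] is almost a multiple of [P k]. *)
Record separated_scales (B : set nat) (b P N m : nat -> nat) : Prop := {
  b_gt0 : forall k, 0 < b k;
  m_gt1 : forall k, 1 < m k;
  mulmb_leP : forall k, m k * b k <= P k;
  mulmrem_leP : forall k, m k * (b k.+1 %% P k) <= P k;
  mulmP_leN : forall k, m k * P k <= N k;
  mulmN_leb : forall k, m k * N k <= b k.+1;
  m_cvgy : m k @[k --> \oo] --> \oo;
  gap_b : forall k y, B y -> y <= b k \/ b k.+1 <= y }.

Lemma highly_sparse_scales (R : realType) (B : set nat) :
  B `<=` positive_nats -> highly_sparse R B ->
  exists b P N m, separated_scales B b P N m.
Proof.
move=> Bpos /(highly_sparse_gaps Bpos)[b [b_pos b_ratio b_gap]].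
have [m m_cvg m_ratio] := diagonal_near (fun c => b_ratio (c ^ 5)).
have m_gt : \forall k \near \oo, 1 < m k by move/cvgnyPge: m_cvg; exact.
have [K _ mK] := filterI m_ratio m_gt.
have {}m_ratio k : m (k + K) ^ 5 * b (k + K) <= b (k + K).+1.
  by case: (mK (k + K)) => //=; rewrite leq_addl.
have {}m_gt k : 1 < m (k + K) by case: (mK (k + K)) => //=; rewrite leq_addl.
have sqr_m_gt0 k : 0 < m (k + K) ^ 2 by rewrite expn_gt0 (ltnW (m_gt k)).
(* Dividing by [m ^ 2] leaves a remainder below [m ^ 2] modulo [P k], while
   [P k >= m ^ 3]. *)
pose P k := b (k + K).+1 %/ m (k + K) ^ 2.
have P_ge k : m (k + K) ^ 3 * b (k + K) <= P k.
  by rewrite leq_divRL // mulnAC -expnD.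
have bK_pos k := b_pos (k + K).
exists (fun k => b (k + K)), P, (fun k => m (k + K) * P k), (fun k => m (k + K)).
split=> //=.
- by move=> k; apply: leq_trans (P_ge k); rewrite leq_mul2r; have := m_gt k; nia.
- move=> k; apply: leq_trans (P_ge k); rewrite expnS -mulnA leq_mul2l addSn.
  by rewrite (leq_trans (ltnW (modn_divn_lt _ (sqr_m_gt0 k)))) ?orbT // leq_pmulr.
- by move=> k; rewrite mulnA mulnn addSn mulnC leq_trunc_div.
- exact: cvg_comp (cvg_addnr K) m_cvg.
- by move=> k y; exact: b_gap.
Qed.

(* These intervals contain the sums in the [k]-th block whose first summand lies in
   an earlier block. *)
Definition carries (b N : nat -> nat) (k : nat) : set nat :=
  [set x | N k < x <= N k + b k] `|` [set x | b k.+1 < x <= b k.+1 + N k].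

Definition residue_shift (b P : nat -> nat) (k : nat) : nat :=
  maxn (b k) (b k.+1 %% P k).

Section Scales.
Variables (B : set nat) (b P N m : nat -> nat).
Hypothesis sc : separated_scales B b P N m.

Lemma scales_m_gt0 k : 0 < m k.
Proof. exact: ltnW (m_gt1 sc k). Qed.

Lemma scales_b_leP k : b k <= P k.
Proof. exact: leq_trans (leq_pmull _ (scales_m_gt0 k)) (mulmb_leP sc k). Qed.

Lemma scales_P_gt0 k : 0 < P k.
Proof. exact: leq_trans (b_gt0 sc k) (scales_b_leP k). Qed.

Lemma scales_P_leN k : P k <= N k.
Proof. exact: leq_trans (leq_pmull _ (scales_m_gt0 k)) (mulmP_leN sc k). Qed.

Lemma scales_mulmN_leN k : m k * N k <= N k.+1.
Proof.
apply: leq_trans (mulmN_leb sc k) _.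
exact: leq_trans (scales_b_leP k.+1) (scales_P_leN k.+1).
Qed.

Lemma scales_N_lt_mulmN k : N k < m k * N k.
Proof.
by rewrite ltn_Pmull ?(m_gt1 sc) // (leq_trans (scales_P_gt0 k) (scales_P_leN k)).
Qed.

Lemma scales_N_lt k : N k < N k.+1.
Proof. exact: leq_trans (scales_N_lt_mulmN k) (scales_mulmN_leN k). Qed.

Lemma scales_residue_shift_leP k : m k * residue_shift b P k <= P k.
Proof. by rewrite maxnMr geq_max (mulmb_leP sc) (mulmrem_leP sc). Qed.

Lemma sumset_block_residues_sub h k x : N k < x <= N k.+1 ->
  sumset (block_residues P h N) B x ->
  low_residues (P k) (h k + residue_shift b P k) x \/ carries b N k x.
Proof.
move=> /andP[Nx xN] [a Aa [y By axy]].
have N_lt_b : N k.+1 < b k.+2.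
  exact: leq_trans (scales_N_lt_mulmN k.+1) (mulmN_leb sc k.+1).
have y_cases : y <= b k \/ y = b k.+1.
  by case: (gap_b sc k By) (gap_b sc k.+1 By) => [?|?] [?|?]; lia.
have [aN|Na] := leqP a (N k).
  have [j _ [/= /andP[Na _] _]] := Aa.
  by right; case: y_cases => yb; [left|right] => /=; lia.
have a_block : N k < a <= N k.+1 by lia.
left; rewrite -axy; apply: low_residuesD.
  exact/(block_residuesE P h scales_N_lt a_block).
rewrite leq_max; case: y_cases => [yb|->]; last by rewrite leqnn orbT.
by rewrite (leq_trans (leq_mod _ _)).
Qed.

Lemma counting_function_carries_le k v : N k <= v ->
  m k * counting_function (carries b N k) v <= 2 * v.
Proof.
move=> Nv; rewrite mul2n -addnn.
apply: leq_trans (leq_mul (leqnn _) (counting_functionU_le _ _ _)) _.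
rewrite !counting_function_itv mulnDr leq_add //.
  apply: leq_trans (leq_mul (leqnn _) (geq_minr _ _)) _.
  exact: leq_trans (mulmb_leP sc k) (leq_trans (scales_P_leN k) Nv).
have [vb|bv] := leqP v (b k.+1); first by rewrite (eqP vb) min0n muln0.
apply: leq_trans (leq_mul (leqnn _) (geq_minr _ _)) _.
exact: leq_trans (mulmN_leb sc k) (ltnW bv).
Qed.

End Scales.

Local Open Scope ring_scope.

Definition discrepancy (R : realType) (alpha : R) (S : set nat) (n : nat) : R :=
  (counting_function S n)%:R - alpha * n%:R.

(* One-sided: only [limsup f n / n <= 0] is required. *)
Definition sublinear (R : realType) (f : nat -> R) : Prop :=
  forall e, 0 < e -> \forall n \near \oo, f n <= e * n%:R.

Lemma sublinear_cst (R : realType) (c : R) : sublinear (fun=> c).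
Proof.
move=> e e0; apply: filterS (nbhs_infty_ger (c / e)) => n.
by rewrite ler_pdivrMr // mulrC.
Qed.

Lemma sublinear_leD (R : realType) (f g h : nat -> R) :
  (forall n, f n <= g n + h n) -> sublinear g -> sublinear h -> sublinear f.
Proof.
move=> fgh sub_g sub_h e e0; have e2 : 0 < e / 2 by rewrite divr_gt0.
apply: filterS2 (sub_g _ e2) (sub_h _ e2) => n gn hn.
by rewrite (le_trans (fgh n)) // [e]splitr mulrDl lerD.
Qed.

Lemma sublinear_blocks (R : realType) (N m : nat -> nat) (C : R) (f : nat -> R) :
  (forall k, (0 < m k)%N) -> m k @[k --> \oo] --> \oo ->
  (forall k, (N k < N k.+1)%N) -> (forall k, (m k * N k <= N k.+1)%N) ->
  0 <= C -> (forall n, f n <= n%:R) ->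
  (forall k v, (N k <= v <= N k.+1)%N -> f v <= f (N k) + C * (v%:R / (m k)%:R)) ->
  sublinear f.
Proof.
move=> m0 m_cvg N_incr mN C0 f_le f_block e e0.
have m0R k : 0 < (m k)%:R :> R by rewrite ltr0n.
pose d := e / (2 * C + 1); have denom_gt0 : 0 < 2 * C + 1 by lra.
have d0 : 0 < d by rewrite divr_gt0.
have [K _ mK] : \forall k \near \oo, d^-1 <= (m k)%:R.
  move/cvgnyPge: m_cvg => /(_ (Num.truncn d^-1).+1); apply: filterS => k.
  by rewrite -(ler_nat R); apply: le_trans; exact/ltW/truncnS_gt.
have div_m k (x : R) : (K <= k)%N -> 0 <= x -> x / (m k)%:R <= d * x.
  by move=> Kk x0; rewrite mulrC ler_wpM2r // invf_ple ?posrE ?mK.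
exists (N K.+1) => // v NKv.
have [[|k] // Kk /andP[Nkv vNk]] := itv_of_increasing N_incr NKv.
have NkvR : (N k.+1)%:R <= v%:R :> R by rewrite ler_nat.
have block_v := f_block k.+1 v ltac:(lia).
have block_N := f_block k (N k.+1) ltac:(by rewrite leqnn ltnW).
have start : f (N k) <= d * v%:R.
  apply: le_trans (f_le _) _; apply: le_trans (div_m k _ Kk _) => //.
  rewrite ler_pdivlMr // -natrM ler_nat mulnC; exact: leq_trans (mN k) Nkv.
have err_v := ler_wpM2l C0 (div_m k.+1 v%:R (leqW Kk) (ler0n _ _)).
have err_N : C * ((N k.+1)%:R / (m k)%:R) <= C * (d * v%:R).
  by rewrite ler_wpM2l // (le_trans (div_m _ _ Kk _)) // ler_wpM2l // ltW.
have -> : e * v%:R = 2 * (C * (d * v%:R)) + d * v%:R.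
  by rewrite /d; field; rewrite gt_eqF.
by lra.
Qed.

Lemma has_density_discrepancy (R : realType) (alpha : R) (S : set nat) :
  sublinear (discrepancy alpha S) -> sublinear (fun n => - discrepancy alpha S n) ->
  has_density S alpha.
Proof.
move=> upper lower.
suff cvg : ((counting_function S n)%:R / n%:R : R)%:E @[n --> \oo] --> alpha%:E.
  by rewrite /has_density /lower_density /upper_density !(cvg_limn_einf_sup cvg).
apply: cvg_EFin; first exact: nearW.
apply/cvgrPdist_le => e e0; have n_gt0 := nbhs_infty_gt 0.
apply: filterS3 n_gt0 (upper e e0) (lower e e0) => n n0 up low.
have n0R : 0 < n%:R :> R by rewrite ltr0n.
have -> : alpha - (counting_function S n)%:R / n%:R =
    - discrepancy alpha S n / n%:R.
  by rewrite /discrepancy; field; rewrite gt_eqF.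
rewrite normrM normfV normrN (gtr0_norm n0R) ler_pdivrMr //.
by rewrite ler_norml lerNl low up.
Qed.

Lemma discrepancy_norm_le (R : realType) (alpha : R) (S : set nat) (n : nat) :
  0 <= alpha <= 1 -> `|discrepancy alpha S n| <= n%:R.
Proof.
move=> /andP[a0 a1]; have c_le : (counting_function S n)%:R <= n%:R :> R.
  by rewrite ler_nat counting_function_le.
have an_le : alpha * n%:R <= n%:R by rewrite ler_piMl.
have an_ge : 0 <= alpha * n%:R by rewrite mulr_ge0.
by rewrite /discrepancy ler_norml; have := ler0n R (counting_function S n); lra.
Qed.

Lemma discrepancy_increment_le (R : realType) (alpha : R) (S T U : set nat)
    (u v : nat) :
  (u <= v)%N -> (forall x, (u < x <= v)%N -> S x -> T x \/ U x) ->
  discrepancy alpha S v - discrepancy alpha S u <=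
  discrepancy alpha T v - discrepancy alpha T u + (counting_function U v)%:R.
Proof.
move=> uv /(counting_function_increment_le uv).
by rewrite -(ler_nat R) !natrD /discrepancy; lra.
Qed.

Lemma discrepancy_low_residues_increment (R : realType) (alpha s : R)
    (P h u v : nat) :
  (0 < P)%N -> (h <= P)%N -> `|h%:R - alpha * P%:R| <= s -> (u <= v)%N ->
  `|discrepancy alpha (low_residues P h) v -
    discrepancy alpha (low_residues P h) u| <=
  P%:R + s * v%:R / P%:R.
Proof.
move=> P0 hP slope uv; have P0R : 0 < P%:R :> R by rewrite ltr0n.
have uvR : 0 <= v%:R - u%:R :> R by rewrite subr_ge0 ler_nat.
have := counting_function_low_residues_bounds u P0 hP.
have := counting_function_low_residues_bounds v P0 hP.
rewrite /discrepancy.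
set cu := counting_function _ u; set cv := counting_function _ v.
rewrite -!(ler_nat R) !natrD !natrM !natrD => v_bounds u_bounds.
rewrite -(ler_pM2l P0R) -{1}(gtr0_norm P0R) -normrM.
have -> : P%:R * (P%:R + s * v%:R / P%:R) = P%:R * P%:R + s * v%:R.
  by field; rewrite gt_eqF.
have -> : P%:R * (cv%:R - alpha * v%:R - (cu%:R - alpha * u%:R)) =
    (P%:R * (cv%:R - cu%:R) - h%:R * (v%:R - u%:R)) +
    (h%:R - alpha * P%:R) * (v%:R - u%:R) by ring.
apply: le_trans (ler_normD _ _) _; apply: lerD.
  by rewrite ler_norml; lra.
rewrite normrM (ger0_norm uvR) ler_pM //.
by rewrite gerBl.
Qed.

Section SublinearDiscrepancy.
Variables (R : realType) (alpha : R) (B : set nat) (b P N m h : nat -> nat).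
Hypotheses (alpha01 : 0 <= alpha <= 1) (sc : separated_scales B b P N m).
Hypothesis h_floor : forall k, (h k)%:R <= alpha * (P k)%:R <= (h k)%:R + 1.

Let A : set nat := block_residues P h N.

Lemma ler_div_scale k x v : (m k * x <= v)%N -> x%:R <= v%:R / (m k)%:R :> R.
Proof.
by rewrite ler_pdivlMr ?ltr0n ?(scales_m_gt0 sc) // -natrM ler_nat mulnC.
Qed.

Lemma discrepancy_low_residues_block k d s v : (d <= P k)%N ->
  `|d%:R - alpha * (P k)%:R| <= s%:R -> (m k * s <= P k)%N -> (N k <= v)%N ->
  `|discrepancy alpha (low_residues (P k) d) v -
    discrepancy alpha (low_residues (P k) d) (N k)| <= 2 * (v%:R / (m k)%:R).
Proof.
move=> dP slope ms Nv; have P0 := scales_P_gt0 sc k.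
have P0R : 0 < (P k)%:R :> R by rewrite ltr0n.
apply: le_trans (discrepancy_low_residues_increment P0 dP slope Nv) _.
rewrite [2]/(1 + 1) mulrDl !mul1r lerD //.
  by rewrite ler_div_scale // (leq_trans (mulmP_leN sc k)).
by rewrite mulrAC mulrC ler_wpM2l // ler_pdivrMr // mulrC ler_div_scale.
Qed.

Lemma mulr_alpha_leP k : alpha * (P k)%:R <= (P k)%:R.
Proof. by have /andP[_ alpha1] := alpha01; rewrite ler_piMl. Qed.

Lemma discrepancy_block_residues_ge k v : (N k <= v <= N k.+1)%N ->
  discrepancy alpha A (N k) - 2 * (v%:R / (m k)%:R) <= discrepancy alpha A v.
Proof.
move=> /andP[Nv vN]; have /andP[h_le le_h] := h_floor k.
have h_leP : (h k <= P k)%N.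
  by rewrite -(ler_nat R) (le_trans h_le (mulr_alpha_leP k)).
have h_slope : `|(h k)%:R - alpha * (P k)%:R| <= 1 by rewrite ler_norml; lra.
have m_leP : (m k * 1 <= P k)%N.
  by apply: leq_trans (mulmb_leP sc k); rewrite leq_mul2l (b_gt0 sc) orbT.
have in_A x : (N k < x <= v)%N -> low_residues (P k) (h k) x -> A x \/ set0 x.
  move=> /andP[Nx xv] xh; left.
  have x_block : (N k < x <= N k.+1)%N by rewrite Nx (leq_trans xv).
  exact/(block_residuesE P h (scales_N_lt sc) x_block).
have := discrepancy_increment_le alpha Nv in_A; rewrite counting_function0.
have := discrepancy_low_residues_block (s := 1) h_leP h_slope m_leP Nv.
by rewrite ler_norml; lra.
Qed.

Lemma discrepancy_sumset_le k v : (N k <= v <= N k.+1)%N ->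
  discrepancy alpha (sumset A B) v <=
  discrepancy alpha (sumset A B) (N k) + 4 * (v%:R / (m k)%:R).
Proof.
move=> /andP[Nv vN]; have /andP[h_le le_h] := h_floor k.
set s := residue_shift b P k; pose d := minn (h k + s) (P k).
have s_ge1 : 1 <= s%:R :> R by rewrite ler1n leq_max (b_gt0 sc).
have d_slope : `|d%:R - alpha * (P k)%:R| <= s%:R.
  have d_le : d%:R <= (h k)%:R + s%:R :> R by rewrite -natrD ler_nat geq_minl.
  have d_ge : alpha * (P k)%:R <= d%:R.
    by rewrite natr_min natrD le_min mulr_alpha_leP (le_trans le_h) ?lerD2l.
  by rewrite ler_norml; lra.
have covered x : (N k < x <= v)%N -> sumset A B x ->
    low_residues (P k) d x \/ carries b N k x.
  move=> /andP[Nx xv]; rewrite low_residues_minn ?(scales_P_gt0 sc) //.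
  by apply: (sumset_block_residues_sub sc); rewrite Nx (leq_trans xv).
have := discrepancy_increment_le alpha Nv covered.
have := ler_div_scale (counting_function_carries_le sc Nv); rewrite natrM.
have := discrepancy_low_residues_block (geq_minr _ _) d_slope
  (scales_residue_shift_leP sc k) Nv.
by rewrite ler_norml; lra.
Qed.

Lemma sublinear_scales (C : R) (f : nat -> R) :
  0 <= C -> (forall n, f n <= n%:R) ->
  (forall k v, (N k <= v <= N k.+1)%N -> f v <= f (N k) + C * (v%:R / (m k)%:R)) ->
  sublinear f.
Proof.
exact: sublinear_blocks (scales_m_gt0 sc) (m_cvgy sc) (scales_N_lt sc)
  (scales_mulmN_leN sc).
Qed.

Lemma sublinear_opp_discrepancy : sublinear (fun n => - discrepancy alpha A n).
Proof.
apply: (sublinear_scales (C := 2)) => // [n|k v /discrepancy_block_residues_ge].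
  by have := discrepancy_norm_le A n alpha01; rewrite ler_norml; lra.
by lra.
Qed.

Lemma sublinear_discrepancy_sumset : sublinear (discrepancy alpha (sumset A B)).
Proof.
apply: (sublinear_scales (C := 4)) => // [n|]; last exact: discrepancy_sumset_le.
exact: le_trans (ler_norm _) (discrepancy_norm_le _ _ alpha01).
Qed.

End SublinearDiscrepancy.

Theorem theorem1p5 (R : realType) (alpha : R) (B : set nat)
    (alpha01 : 0 <= alpha <= 1)
    (Bpos : B `<=` positive_nats)
    (Bneq0 : B !=set0)
    (Bsparse : highly_sparse R B) :
  exists2 A : set nat, A `<=` positive_nats & has_density (sumset A B) alpha.
Proof.
have [b [P [N [m sc]]]] := highly_sparse_scales Bpos Bsparse.
pose h k := Num.truncn (alpha * (P k)%:R).
have h_floor k : (h k)%:R <= alpha * (P k)%:R <= (h k)%:R + 1.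
  have /andP[alpha0 _] := alpha01; rewrite natr1.
  by have /andP[-> /ltW ->] := truncn_itv (mulr_ge0 alpha0 (ler0n R (P k))).
set A := block_residues P h N; exists A.
  by move=> x [k _ [/= /andP[Nx _] _]]; exact: leq_ltn_trans Nx.
have [y By] := Bneq0; apply: has_density_discrepancy.
  exact: sublinear_discrepancy_sumset alpha01 sc h_floor.
apply: sublinear_leD (sublinear_opp_discrepancy alpha01 sc h_floor)
  (sublinear_cst y%:R) => n.
have := counting_function_sumset_ge A n By.
by rewrite -(ler_nat R) natrD /discrepancy; lra.
Qed.
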